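(* Let $d\ge 2$ be an integer. Among $d$-ary trees with at least two leaves, only the binary caterpillars have inducibility $1$: for a $d$-ary tree $D$ with $|D|\ge 2$, one has $i_d(D)=1$ if and only if $D$ is isomorphic to the binary caterpillar $F^2_{|D|}$.
   Context: All trees are finite and rooted, with unordered children; isomorphism means isomorphism of rooted trees. The single vertex is regarded as a tree whose only vertex is both root and leaf. For a rooted tree $T$, $|T|$ denotes its number of leaves. For an integer $d\ge 2$, a $d$-ary tree is a rooted tree in which every non-leaf vertex has between $2$ and $d$ children; it is strictly $d$-ary if every non-leaf vertex has exactly $d$ children. (An $n$-leaf strictly $d$-ary tree exists iff $n\ge 1$ and $n\equiv 1 \bmod (d-1)$.) A binary tree is a $2$-ary tree. For a nonempty set $S$ of leaves of $T$, the subtree of $T$ induced by $S$ is obtained by taking the minimal subtree of $T$ containing the leaves in $S$, rooting it at the most recent common ancestor of $S$, and suppressing (contracting) all non-root vertices of degree $2$. Let $c(D,T)$ be the number of sets of $|D|$ leaves of $T$ whose induced subtree is isomorphic to $D$, and for $|T|\ge |D|$ let $\gamma(D,T)=c(D,T)/\binom{|T|}{|D|}$. The inducibility of a $d$-ary tree $D$ (in strictly $d$-ary trees) is $$i_d(D)=\limsup_{n\to\infty}\ \max_{|T|=n,\ T\text{ strictly }d\text{-ary}}\gamma(D,T),$$ where $n$ ranges over integers $n\equiv 1 \bmod (d-1)$. The binary caterpillar $F^2_k$ ($k\ge 2$) is the binary tree with $k$ leaves in which the non-leaf vertices form a path starting at the root, every non-leaf vertex except the lowest has exactly one leaf child (and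 one non-leaf child), and the lowest non-leaf vertex has two leaf children. *)

(* Defs.v *)
From HB Require Import structures.
From mathcomp Require Import all_boot all_order all_algebra.
From mathcomp Require Import all_classical all_reals all_analysis.

Set Implicit Arguments.
Unset Strict Implicit.
Unset Printing Implicit Defensive.

Import Order.TTheory GRing.Theory Num.Theory.

(* Finite rooted trees. The list of children is ordered, which is immaterial:
   trees are only ever compared up to [tree_iso]. [Node [::]] is the single
   vertex, both root and leaf. *)
Inductive tree := Node of seq tree.

Definition children (T : tree) : seq tree := let: Node ts := T in ts.

Definition leaf : tree := Node [::].

Fixpoint tree_encode (T : tree) : GenTree.tree void :=
  let: Node ts := T in GenTree.Node 0 (map tree_encode ts).

Fixpoint tree_decode (t : GenTree.tree void) : tree :=
  if t is GenTree.Node _ ts then Node (map tree_decode ts) else leaf.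

Lemma tree_encodeK : cancel tree_encode tree_decode.
Proof.
rewrite /cancel; fix IH 1; case=> ts /=; congr Node.
by elim: ts => [//|t ts IHts] /=; rewrite IH IHts.
Qed.

HB.instance Definition _ := Countable.copy tree (can_type tree_encodeK).

(* Isomorphism of rooted trees with unordered children: after reordering the
   children of one root, the branches are pairwise isomorphic. *)
Fixpoint tree_iso (T1 T2 : tree) : bool :=
  has (fun ts => all2 tree_iso (children T1) ts) (permutations (children T2)).

Fixpoint dary (d : nat) (T : tree) : bool :=
  let: Node ts := T in
  ((ts == [::]) || (2 <= size ts <= d)) && all (dary d) ts.

Fixpoint strictly_dary (d : nat) (T : tree) : bool :=
  let: Node ts := T in
  ((ts == [::]) || (size ts == d)) && all (strictly_dary d) ts.

(* [mapi f i [:: x0; x1; ...] = [:: f i x0; f i.+1 x1; ...]] *)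
Definition mapi (A B : Type) (f : nat -> A -> B) : nat -> seq A -> seq B :=
  fix go i s := if s is x :: s' then f i x :: go i.+1 s' else [::].

(* A vertex is identified by its address, the list of child indices met on the
   way down from the root. *)
Definition address := seq nat.

Fixpoint leaves (T : tree) : seq address :=
  let: Node ts := T in
  if ts is [::] then [:: [::]]
  else flatten (mapi (fun i t => map (cons i) (leaves t)) 0 ts).

Definition nleaves (T : tree) : nat := size (leaves T).

Definition leaf_of (T : tree) := seq_sub (leaves T).

(* The part of T made of the root and of all vertices that have a descendant
   leaf (possibly themselves) with address in P. *)
Fixpoint prune (P : pred address) (T : tree) : tree :=
  let: Node ts := T in
  Node (flatten (mapi (fun i t =>
    let Pi := fun a => P (i :: a) in
    if has Pi (leaves t) then [:: prune Pi t] else [::]) 0 ts)).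

(* Moves the root down to the first vertex that does not have exactly one
   child. On a pruned tree this is the most recent common ancestor of the
   selected leaves, so what remains is the minimal subtree containing them. *)
Fixpoint reroot (T : tree) : tree :=
  match T with
  | Node [:: t] => reroot t
  | _ => T
  end.

Fixpoint contract (T : tree) : tree :=
  match T with
  | Node [:: t] => contract t
  | Node ts => Node (map contract ts)
  end.

(* A non-root vertex has degree 2 iff it has exactly one child. *)
Definition suppress (T : tree) : tree := Node (map contract (children T)).

(* Meaningful for nonempty S. *)
Definition induced (T : tree) (S : {set leaf_of T}) : tree :=
  suppress (reroot (prune (fun a => a \in [seq val x | x in S]) T)).

Definition copies (D T : tree) : nat :=
  #|[set S : {set leaf_of T} |
      (#|S| == nleaves D) && tree_iso (induced S) D]|.

Local Open Scope classical_set_scope.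
Local Open Scope ring_scope.

(* Only used for nleaves D <= nleaves T (it is 0 otherwise). *)
Definition density (R : realType) (D T : tree) : R :=
  (copies D T)%:R / 'C(nleaves T, nleaves D)%:R.

(* There are finitely many strictly d-ary trees with n leaves, so for
   n = 1 mod (d-1) the supremum below is a maximum. *)
Definition max_density (R : realType) (d : nat) (D : tree) (n : nat) : \bar R :=
  ereal_sup [set (density R D T)%:E | T in
              [set T : tree | strictly_dary d T /\ nleaves T = n]].

(* The integers n >= 1 with n = 1 mod (d-1) are enumerated increasingly as
   (d-1) m + 1; extended reals make the limit superior total. *)
Definition inducibility (R : realType) (d : nat) (D : tree) : \bar R :=
  limn_esup (fun m : nat => max_density R d D (d.-1 * m).+1).

(* The binary caterpillar with k leaves; meaningful for k >= 2, the first
   iteration creates the vertex with two leaf children. *)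
Definition caterpillar (k : nat) : tree :=
  iter k.-1 (fun T => Node [:: leaf; T]) leaf.

(* Main.v *)
(* If D is not the binary caterpillar with k leaves: among any d^k leaves of a
   d-ary tree some k induce the caterpillar (descend to a child carrying at
   least a fraction 1/d of the leaves, and pick one leaf off the path whenever
   another child carries one). Hence every d^k-subset of leaves contains a
   k-subset that is not a copy of D, and double counting bounds all densities
   by 1 - 1/'C(d^k, k). Conversely, in the strictly d-ary caterpillar k leaves
   at pairwise distinct depths induce the binary caterpillar, and only a
   fraction O(1/n) of the k-subsets of leaves has two leaves at equal depth. *)

Require Import Defs.
From HB Require Import structures.
From mathcomp Require Import all_boot all_order all_algebra.
From mathcomp Require Import all_classical all_reals all_analysis.
From mathcomp Require Import zify.

Set Implicit Arguments.
Unset Strict Implicit.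
Unset Printing Implicit Defensive.

(** The generated induction principle says nothing about trees nested in the list of children; an
    inner induction on that list supplies the hypothesis. *)
Lemma tree_nested_ind (P : tree -> Prop) :
  (forall ts, {in ts, forall t, P t} -> P (Node ts)) -> forall T, P T.
Proof.
move=> IH; fix rec 1; case=> ts; apply: IH.
elim: ts => [|t ts IHts] u; first by clear rec; rewrite in_nil.
rewrite inE => /predU1P[->|]; first exact: rec.
exact: IHts.
Qed.

(** * Isomorphism via a normal form *)

(* Any total order on trees would do. *)
Definition tree_le : rel tree := fun s t => (pickle s <= pickle t)%N.

Fixpoint normal_form (T : tree) : tree :=
  let: Node ts := T in Node (sort tree_le (map normal_form ts)).

Lemma sort_tree_leP (s t : seq tree) :
  reflect (sort tree_le s = sort tree_le t) (perm_eq s t).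
Proof.
apply: perm_sortP => [x y|y x z|x y /anti_leq/(pcan_inj pickleK)//].
  exact: leq_total.
exact: leq_trans.
Qed.

Lemma normal_form_Node (s t : seq tree) :
  (normal_form (Node s) == normal_form (Node t)) =
  perm_eq (map normal_form s) (map normal_form t).
Proof. by apply/eqP/sort_tree_leP => /= [[]|->]. Qed.

(** Since [f] may identify distinct entries, the reordering is transported along positions rather
    than values. *)
Lemma perm_eq_mapP (A B : eqType) (f : A -> B) (s : seq B) (t : seq A) :
  reflect (exists2 u, perm_eq u t & s = map f u) (perm_eq s (map f t)).
Proof.
apply: (iffP idP) => [|[u ut ->]]; last exact: perm_map.
case: t => [/perm_nilP -> |x0 t]; first by exists [::].
move=> /(perm_iotaP (f x0))[is_ is_t ->].
rewrite size_map in is_t; exists [seq nth x0 (x0 :: t) i | i <- is_].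
  by apply/(perm_iotaP x0); exists is_.
rewrite -map_comp; apply/eq_in_map => i.
by rewrite (perm_mem is_t) mem_iota => /andP[_ ilt]; rewrite /= -(nth_map x0 (f x0)).
Qed.

(** Replaces the search over permutations at every vertex by an equality, from which [tree_iso]
    inherits being an equivalence relation. *)
Lemma tree_isoE (T1 T2 : tree) :
  tree_iso T1 T2 = (normal_form T1 == normal_form T2).
Proof.
elim/tree_nested_ind: T1 T2 => s IH [t].
have all2E u : all2 tree_iso s u = (map normal_form s == map normal_form u).
  elim: s IH u => [|x s IHs] IH [|y u] //=.
  rewrite IH ?mem_head// IHs ?eqseq_cons// => z zs.
  by apply: IH; rewrite inE zs orbT.
rewrite normal_form_Node /=; apply/hasP/perm_eq_mapP => -[u].
  rewrite mem_permutations perm_sym all2E => ut /eqP ->.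
  by exists u => //; rewrite perm_sym.
by move=> ut su; exists u; rewrite ?mem_permutations// all2E su.
Qed.

Lemma tree_iso_trans : transitive tree_iso.
Proof. by move=> T2 T1 T3; rewrite !tree_isoE => /eqP->. Qed.

Lemma tree_iso_sym : symmetric tree_iso.
Proof. by move=> T1 T2; rewrite !tree_isoE eq_sym. Qed.

Lemma tree_iso_refl : reflexive tree_iso.
Proof. by move=> T; rewrite tree_isoE. Qed.

(** [contract] treats singletons apart, but lists of length at most 1 that are permutations of each
    other are equal, and longer lists keep their root on both sides. *)
Lemma perm_contract_iso (s t : seq tree) :
  perm_eq s t -> tree_iso (Defs.contract (Node s)) (Defs.contract (Node t)).
Proof.
move=> st; have [ts|] := leqP (size t) 1.
  by rewrite (perm_small_eq ts st) tree_iso_refl.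
move: st (perm_size st).
case: s => [|a [|b s]]; case: t => [|c [|e t]]// st _ _.
by rewrite tree_isoE !normal_form_Node; apply/perm_map/perm_map.
Qed.

(** * Leaves and pruning *)

Lemma mapiE (A B : Type) (x0 : A) (f : nat -> A -> B) (s : seq A) (n : nat) :
  mapi f n s = [seq f (n + i) (nth x0 s i) | i <- iota 0 (size s)].
Proof.
elim: s n => [//|x s IHs] n /=; rewrite addn0; congr cons.
rewrite -/(mapi f n.+1 s) IHs (iotaDl 1 0) -map_comp.
by apply: eq_map => i /=; rewrite addnA addn1.
Qed.

Local Notation child ts i := (nth leaf ts i).

Lemma leaves_Node (ts : seq tree) : ts != [::] ->
  leaves (Node ts) = [seq i :: a | i <- iota 0 (size ts), a <- leaves (child ts i)].
Proof.
case: ts => [//|t ts] _.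
pose lv i u := [seq i :: a | a <- leaves u].
by rewrite -[LHS]/(flatten (mapi lv 0 (t :: ts))) (mapiE leaf).
Qed.

Lemma mem_leaves_Node (ts : seq tree) (i : nat) (a : address) :
  (i :: a \in leaves (Node ts)) = (i < size ts) && (a \in leaves (child ts i)).
Proof.
case: ts => [|t ts]; first by rewrite inE.
rewrite leaves_Node//; apply/allpairsPdep/andP.
  by move=> [j [b [jts bj [-> ->]]]]; rewrite mem_iota in jts.
by move=> [ilt ai]; exists i, a; rewrite mem_iota.
Qed.

(** Records indices rather than subtrees, because the selection inside child [i] is
    [P \o cons i]. *)
Definition kept (P : pred address) (ts : seq tree) : seq nat :=
  [seq i <- iota 0 (size ts) | has (P \o cons i) (leaves (child ts i))].

Lemma prune_Node (P : pred address) (ts : seq tree) :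
  prune P (Node ts) = Node [seq prune (P \o cons i) (child ts i) | i <- kept P ts].
Proof.
congr Node; rewrite (mapiE leaf) /kept.
elim: (iota _ _) => [//|i s IHs] /=; rewrite IHs add0n.
by case: ifP.
Qed.

Lemma uniq_leaves (T : tree) : uniq (leaves T).
Proof.
elim/tree_nested_ind: T => -[//|t ts] IH; rewrite leaves_Node//.
apply: allpairs_uniq_dep; first exact: iota_uniq.
- move=> i; rewrite mem_iota => /andP[_ ilt].
  by apply: IH; apply: mem_nth.
- by move=> [i a] [j b] _ _ /= [-> ->].
Qed.

Lemma count_leaves (P : pred address) (ts : seq tree) : ts != [::] ->
  count P (leaves (Node ts)) =
  \sum_(i <- iota 0 (size ts)) count (P \o cons i) (leaves (child ts i)).
Proof.
move=> ts0; rewrite leaves_Node// count_flatten sumnE big_map big_map.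
by apply: eq_bigr => i _; rewrite count_map.
Qed.

(** Discarded children contribute zero. In this form one list governs both the leaf count and the
    shape of the pruned tree. *)
Lemma count_leaves_kept (P : pred address) (ts : seq tree) : ts != [::] ->
  count P (leaves (Node ts)) =
  \sum_(i <- kept P ts) count (P \o cons i) (leaves (child ts i)).
Proof.
move=> ts0; rewrite count_leaves// /kept big_filter.
rewrite (bigID (fun i => has (P \o cons i) (leaves (child ts i))))/=.
rewrite [X in (_ + X)%N]big1 ?addn0// => i.
by rewrite has_count -eqn0Ngt => /eqP.
Qed.

Lemma eq_in_prune (P Q : pred address) (T : tree) :
  {in leaves T, P =1 Q} -> prune P T = prune Q T.
Proof.
elim/tree_nested_ind: T P Q => -[//|t ts] IH P Q PQ.
have PQi i : i < size (t :: ts) ->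
    {in leaves (child (t :: ts) i), (P \o cons i) =1 (Q \o cons i)}.
  by move=> ilt a a_i; apply: PQ; rewrite mem_leaves_Node ilt.
have keptE : kept P (t :: ts) = kept Q (t :: ts).
  by apply: eq_in_filter => i; rewrite mem_iota => /andP[_ ilt]; apply/eq_in_has/PQi.
rewrite !prune_Node keptE; congr Node; apply/eq_in_map => i.
rewrite mem_filter mem_iota => /and3P[_ _ ilt].
by apply: IH; [exact: mem_nth|exact: PQi].
Qed.

(* Rerooting followed by suppression is [contract], see [suppress_reroot]. *)
Definition trestrict (P : pred address) (T : tree) : tree := Defs.contract (prune P T).

Lemma suppress_reroot (T : tree) : suppress (reroot T) = Defs.contract T.
Proof. by elim/tree_nested_ind: T => -[|t [|u ts]] IH //=; rewrite IH// mem_head. Qed.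

Lemma trestrict_Node1 (P : pred address) (ts : seq tree) (i : nat) :
  perm_eq (kept P ts) [:: i] ->
  trestrict P (Node ts) = trestrict (P \o cons i) (child ts i).
Proof.
by move=> /perm_small_eq ki; rewrite /trestrict prune_Node ki.
Qed.

(** Stated up to permutation so that the child providing the leaf of a caterpillar can be put
    first. *)
Lemma trestrict_Node2 (P : pred address) (ts : seq tree) (i j : nat) :
  perm_eq (kept P ts) [:: i; j] ->
  tree_iso (trestrict P (Node ts))
    (Node [:: trestrict (P \o cons i) (child ts i);
              trestrict (P \o cons j) (child ts j)]).
Proof.
move=> kij; rewrite /trestrict prune_Node.
exact: perm_contract_iso (perm_map _ kij).
Qed.

Lemma tree_iso_Node2 (s1 s2 t1 t2 : tree) :
  tree_iso s1 t1 -> tree_iso s2 t2 ->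
  tree_iso (Node [:: s1; s2]) (Node [:: t1; t2]).
Proof.
by rewrite !tree_isoE normal_form_Node /= => /eqP-> /eqP->.
Qed.

(** * Caterpillars in large trees *)

Lemma pigeonhole_sum (I : eqType) (s : seq I) (c : I -> nat) (m : nat) :
  m * size s < \sum_(i <- s) c i -> exists2 i, i \in s & m < c i.
Proof.
move=> lt_sum; apply/hasP; apply: contraLR lt_sum => /hasPn le_m.
have -> : m * size s = \sum_(i <- s) m.
  by rewrite big_const_seq count_predT iter_addn_0.
rewrite -leqNgt big_seq [leqRHS]big_seq.
by apply: leq_sum => i /le_m; rewrite -leqNgt.
Qed.

(** Glues one selection per child into a selection at the parent, so that [assemble F \o cons i] is
    convertible to [F i]. *)
Definition assemble (F : nat -> pred address) : pred address :=
  fun a => if a is i :: b then F i b else false.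

Lemma kept_perm (P : pred address) (ts : seq tree) (s : seq nat) : uniq s ->
  (forall i, (i \in s) = (i < size ts) && has (P \o cons i) (leaves (child ts i))) ->
  perm_eq (kept P ts) s.
Proof.
move=> uniq_s sE; apply: uniq_perm => //; first exact/filter_uniq/iota_uniq.
by move=> i; rewrite sE mem_filter mem_iota andbC.
Qed.

(** Induction on [T] for all [P] and [k]. If all selected leaves lie below one child, recurse there
    with the same [k]; otherwise a child with a fraction at least 1/d of them yields the caterpillar
    for [k - 1], and another child yields the extra leaf. *)
Lemma exists_caterpillar (d : nat) (T : tree) (P : pred address) (k : nat) :
  2 <= d -> strictly_dary d T -> d ^ k <= count P (leaves T) ->
  exists Q : pred address, [/\ subpred Q P, count Q (leaves T) = k.+1 &
    tree_iso (trestrict Q T) (caterpillar k.+1)].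
Proof.
move=> d2; elim/tree_nested_ind: T P k => -[|t ts] IH P k.
  (* A single leaf gives a count of at most 1, and [d ^ k <= 1] forces [k = 0]. *)
  move=> _ /= cP; have k0 : k = 0.
    apply/eqP; rewrite -leqn0 leqNgt; apply/negP => k0.
    have := leq_pexp2l (ltnW d2) k0; case: (P [::]) cP; rewrite expn1; lia.
  subst k; exists P; split=> //=.
  by case: (P [::]) cP.
move: (t :: ts) (isT : t :: ts != [::]) IH => {t ts} ts ts0 IH.
rewrite [strictly_dary _ _]/= (negbTE ts0) => /andP[/eqP szts darys].
have {darys}IHi i (ilt : i < size ts) p l :=
  IH _ (mem_nth leaf ilt) p l (all_nthP leaf darys i ilt).
have has_kept i : i \in kept P ts -> i < size ts /\ d ^ 0 <= count (P \o cons i) (leaves (child ts i)).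
  by rewrite mem_filter mem_iota -has_count => /and3P[].
(* Selecting nothing outside child [i] leaves the root with one child, and [contract] removes it. *)
have single i l : i < size ts -> d ^ l <= count (P \o cons i) (leaves (child ts i)) ->
    exists Q : pred address, [/\ subpred Q P, count Q (leaves (Node ts)) = l.+1 &
      tree_iso (trestrict Q (Node ts)) (caterpillar l.+1)].
  move=> ilt /(IHi i ilt)[Q [QP cQ isoQ]].
  pose F c := if c == i then Q else pred0.
  have kF : perm_eq (kept (assemble F) ts) [:: i].
    apply: kept_perm => // c; rewrite inE -[assemble F \o _]/(F c) /F.
    by case: eqP => [->|_]; rewrite ?has_pred0 ?andbF// ilt has_count cQ.
  exists (assemble F); split.
  - by move=> [//|c a]; rewrite /= /F; case: eqP => // -> /QP.
  - rewrite count_leaves_kept// (perm_big _ kF) big_seq1 -[assemble F \o _]/(F i).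
    by rewrite /F eqxx.
  - by rewrite (trestrict_Node1 kF) -[assemble F \o _]/(F i) /F eqxx.
rewrite count_leaves//; case: k => [|k] cP.
  have [i] := @pigeonhole_sum _ _ _ 0 cP.
  by rewrite mem_iota => /andP[_ ilt]; exact: (@single i 0).
(* Exceeding [(d ^ k).-1] means reaching [d ^ k]; the strict bound needed is
   [d * (d ^ k - 1) < d ^ k.+1]. *)
have [|i] := @pigeonhole_sum _ _ _ (d ^ k).-1 (leq_trans _ cP).
  rewrite size_iota szts expnS mulnC ltn_mul2l; have := expn_gt0 d k; lia.
rewrite mem_iota => /andP[_ ilt]; rewrite prednK ?expn_gt0 ?(ltnW d2)// => ci.
have [/hasP[j jkept ji]|/hasPn kept_i] := boolP (has (predC1 i) (kept P ts)); last first.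
  apply: (single i) => //; apply: (leq_trans cP); rewrite -count_leaves//.
  have kept_i1 : perm_eq (kept P ts) [:: i].
    apply: uniq_perm => //; first exact/filter_uniq/iota_uniq.
    move=> c; rewrite inE; apply/idP/eqP => [/kept_i/negPn/eqP//|->].
    rewrite mem_filter mem_iota ilt has_count andbT.
    by rewrite (leq_trans _ ci)// expn_gt0 (ltnW d2).
  by rewrite count_leaves_kept// (perm_big _ kept_i1) big_seq1.
(* The induction hypothesis with exponent 0 picks a single leaf below [j]. *)
have [jlt /(IHi j jlt)[Q' [QP' cQ' isoQ']]] := has_kept j jkept.
have [Q [QP cQ isoQ]] := IHi i ilt _ _ ci.
pose F c := if c == i then Q else if c == j then Q' else pred0.
have Fi : F i = Q by rewrite /F eqxx.
have Fj : F j = Q' by rewrite /F (negbTE ji) eqxx.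
have kF : perm_eq (kept (assemble F) ts) [:: j; i].
  apply: kept_perm => [|c]; first by rewrite /= inE andbT.
  rewrite !inE -[assemble F \o _]/(F c) /F.
  have [->|_] := eqVneq c i; first by rewrite orbT ilt has_count cQ.
  by case: eqP => [->|_]; rewrite ?has_pred0 ?andbF// jlt has_count cQ'.
exists (assemble F); split.
- move=> [//|c a]; rewrite /= /F; case: eqP => [->/QP//|_].
  by case: eqP => // -> /QP'.
- rewrite count_leaves_kept// (perm_big _ kF) big_cons big_seq1.
  by rewrite -[assemble F \o _]/(F j) -[assemble F \o cons i]/(F i) Fi Fj cQ cQ'.
- apply: tree_iso_trans (trestrict_Node2 kF) _.
  rewrite -[assemble F \o _]/(F j) -[assemble F \o cons i]/(F i) Fi Fj.
  exact: (@tree_iso_Node2 _ _ leaf).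
Qed.

(** * Strictly d-ary caterpillars *)

(** The spine runs through child 0, so descending it replaces [P] by [P \o cons 0]; [m] counts the
    non-leaf vertices. *)
Definition dary_caterpillar (d m : nat) : tree :=
  iter m (fun T => Node (T :: nseq d.-1 leaf)) leaf.

Arguments dary_caterpillar : simpl never.

Lemma dary_caterpillarS (d m : nat) :
  dary_caterpillar d m.+1 = Node (dary_caterpillar d m :: nseq d.-1 leaf).
Proof. by []. Qed.

Lemma dary_caterpillar_strict (d m : nat) :
  0 < d -> strictly_dary d (dary_caterpillar d m).
Proof.
move=> d0; elim: m => [//|m IHm]; rewrite dary_caterpillarS /= IHm size_nseq prednK// eqxx/=.
by rewrite all_nseq orbT.
Qed.

Lemma count_dary_caterpillar (d m : nat) (P : pred address) :
  count P (leaves (dary_caterpillar d m.+1)) =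
  count (P \o cons 0) (leaves (dary_caterpillar d m)) +
  \sum_(1 <= i < d.-1.+1) P [:: i].
Proof.
rewrite dary_caterpillarS count_leaves//= size_nseq big_cons; congr addn.
rewrite /index_iota subSS subn0 big_seq [RHS]big_seq; apply: eq_bigr => -[|i].
  by rewrite mem_iota.
by rewrite mem_iota /= nth_nseq if_same/= addn0.
Qed.

Lemma nleaves_dary_caterpillar (d m : nat) :
  nleaves (dary_caterpillar d m) = (d.-1 * m).+1.
Proof.
rewrite /nleaves -count_predT; elim: m => [|m IHm]; first by rewrite muln0.
by rewrite count_dary_caterpillar IHm sum_nat_const_nat subn1 /=; lia.
Qed.

(** A level holds the [d - 1] leaves hanging from one spine vertex, and possibly the end of the
    spine. *)
Lemma count_depth_dary_caterpillar (d m s : nat) : 0 < d ->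
  count (fun a => size a == s) (leaves (dary_caterpillar d m)) <= d.
Proof.
move=> d0; elim: m s => [|m IHm] [|s]//=; rewrite ?count_dary_caterpillar.
- by rewrite (@eq_count _ _ pred0)// count_pred0 big1.
- case: s => [|s]; last first.
    by rewrite sum_nat_const_nat muln0 addn0; exact: IHm.
  rewrite sum_nat_const_nat muln1 subn1/= -[leqRHS](prednK d0) -[leqRHS]add1n leq_add2r.
  rewrite (@eq_count _ _ (pred1 [::])); last by case.
  by rewrite count_uniq_mem ?uniq_leaves ?leq_b1.
Qed.

(* Leaves at pairwise distinct depths hang from distinct vertices of the spine. *)
Lemma dary_caterpillar_restrict (d m k : nat) (P : pred address) :
  {in leaves (dary_caterpillar d m) &, forall a b,
     P a -> P b -> size a = size b -> a = b} ->
  count P (leaves (dary_caterpillar d m)) = k.+1 ->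
  tree_iso (trestrict P (dary_caterpillar d m)) (caterpillar k.+1).
Proof.
elim: m P k => [|m IHm] P k.
  by move=> _ /=; case: (P [::]); case: k.
set T := dary_caterpillar d m in IHm *; pose ts := T :: nseq d.-1 leaf.
have childj j : 0 < j -> child ts j = leaf by case: j => //= j _; rewrite nth_nseq if_same.
rewrite dary_caterpillarS -/T -/ts => Pinj.
have {}IHm k' : count (P \o cons 0) (leaves T) = k'.+1 ->
    tree_iso (trestrict (P \o cons 0) T) (caterpillar k'.+1).
  apply: IHm => a b al bl Pa Pb sab.
  suff [] : 0 :: a = 0 :: b by [].
  by apply: Pinj; rewrite ?mem_leaves_Node//= sab.
(* Children off the spine are leaves at depth 1, so at most one is selected: [kept P ts] has at most
   the spine and one such child. *)
have kept_uniq j j' : 0 < j -> 0 < j' -> j \in kept P ts -> j' \in kept P ts -> j = j'.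
  have memj i : 0 < i -> i \in kept P ts -> [:: i] \in leaves (Node ts) /\ P [:: i].
    move=> i0; rewrite mem_filter mem_iota => /and3P[+ _ ilt].
    by rewrite mem_leaves_Node ilt childj//= orbF.
  move=> j0 j'0 /(memj _ j0)[jl Pj] /(memj _ j'0)[j'l Pj'].
  by have [] : [:: j] = [:: j'] by apply: Pinj.
have uniq_kept : uniq (kept P ts) by exact/filter_uniq/iota_uniq.
have count_j j : 0 < j -> j \in kept P ts -> count (P \o cons j) (leaves (child ts j)) = 1.
  move=> j0; rewrite mem_filter mem_iota => /and3P[+ _ _].
  by rewrite childj//= orbF addn0 => ->.
rewrite count_leaves_kept//.
have [/hasP[j jkept j0]|/hasPn kept0] := boolP (has (leq 1) (kept P ts)); last first.
  have [|kept_nil] := boolP (0 \in kept P ts); last first.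
    have -> : kept P ts = [::]; last by rewrite big_nil.
    case: (kept P ts) kept0 kept_nil => [//|c s] /(_ c (mem_head _ _)).
    by case: c.
  move=> kept_0; have kE : perm_eq (kept P ts) [:: 0].
    apply: uniq_perm => // c; rewrite inE; apply/idP/eqP => [/kept0|->//].
    by case: c.
  by rewrite (perm_big _ kE) big_seq1 (trestrict_Node1 kE) => /IHm.
have [kept_0|kept_n0] := boolP (0 \in kept P ts).
  have kE : perm_eq (kept P ts) [:: j; 0].
    apply: uniq_perm => //=; first by rewrite inE -lt0n j0.
    move=> [|c]; rewrite !inE ?eqxx ?orbT// orbF.
    by apply/idP/eqP => [ck|->//]; exact: kept_uniq.
  rewrite (perm_big _ kE) big_cons big_seq1 count_j// /= add1n => -[].
  have : 0 < count (P \o cons 0) (leaves T).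
    by move: kept_0; rewrite mem_filter has_count => /andP[].
  case: k => [|k] cpos ck; first by rewrite ck in cpos.
  apply: tree_iso_trans (trestrict_Node2 kE) _.
  by apply: (@tree_iso_Node2 _ _ leaf); [rewrite childj|exact: IHm].
have kE : perm_eq (kept P ts) [:: j].
  apply: uniq_perm => // c; rewrite inE; apply/idP/eqP => [ck|->//].
  by apply: kept_uniq => //; case: c ck => //; rewrite (negbTE kept_n0).
by rewrite (perm_big _ kE) big_seq1 (trestrict_Node1 kE) count_j// childj// => -[<-].
Qed.

(** * Counting leaf sets *)

Lemma card_bigcup_leq (I T : finType) (A : {set I}) (F : I -> {set T}) (b : nat) :
  {in A, forall i, #|F i| <= b} -> #|\bigcup_(i in A) F i| <= #|A| * b.
Proof.
move=> Fb; rewrite -sum_nat_const.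
elim/big_rec2: _ => [|i u X iA IH]; first by rewrite cards0.
by rewrite (leq_trans (leq_card_setU _ _))// leq_add// Fb.
Qed.

(** Removing [B] is injective on its supersets. Equality fails when [n < #|B|]: truncated
    subtraction makes the right side 1. *)
Lemma card_supersets_leq (T : finType) (B : {set T}) (n : nat) :
  #|[set S : {set T} | (B \subset S) && (#|S| == n)]| <= 'C(#|T| - #|B|, n - #|B|).
Proof.
have -> : #|T| - #|B| = #|~: B| by rewrite -(cardsC B) addKn.
rewrite -cards_draws -(@card_in_imset _ _ (fun S => S :\: B)).
  apply/subset_leq_card/fintype.subsetP => _ /imsetP[S + ->].
  rewrite !inE => /andP[BS /eqP <-].
  by rewrite cardsD (finset.setIidPr BS) eqxx andbT finset.setDE finset.subsetIr.
move=> S1 S2; rewrite !inE => /andP[B1 _] /andP[B2 _] E.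
by rewrite -(finset.setID S1 B) -(finset.setID S2 B) E (finset.setIidPr B1) (finset.setIidPr B2).
Qed.

(** Both sides count pairs of nested subsets of sizes [k] and [m] in an [n]-set; the proof compares
    factorials. *)
Lemma bin_trinomial (n m k : nat) : k <= m <= n ->
  'C(n, m) * 'C(m, k) = 'C(n, k) * 'C(n - k, m - k).
Proof.
move=> /andP[km mn]; have kn := leq_trans km mn.
have := bin_fact mn; rewrite -(bin_fact km) -(bin_fact kn).
have mkn : m - k <= n - k by rewrite leq_sub2r.
rewrite -(bin_fact mkn) (_ : n - k - (m - k) = n - m); last by lia.
move=> E; apply/eqP; rewrite -(@eqn_pmul2r (k`! * (m - k)`! * (n - m)`!));
  last by rewrite !muln_gt0 !fact_gt0.
by apply/eqP; move: E; lia.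
Qed.

(** Each member of [G] lies in at most ['C(#|T| - k, n - k)] of the [n]-sets, and together these
    cover all ['C(#|T|, n)]; [bin_trinomial] rewrites the resulting bound. *)
Lemma hitting_family_large (T : finType) (G : {set {set T}}) (k n : nat) :
  k <= n <= #|T| -> {in G, forall B : {set T}, #|B| = k} ->
  (forall S : {set T}, #|S| = n -> exists2 B, B \in G & B \subset S) ->
  'C(#|T|, k) <= #|G| * 'C(n, k).
Proof.
move=> /andP[kn nT] cardG hit.
rewrite -(@leq_pmul2r 'C(#|T| - k, n - k)); last by rewrite bin_gt0 leq_sub2r.
rewrite -bin_trinomial ?kn// mulnAC leq_mul2r; apply/orP; right.
rewrite -card_draws.
apply: leq_trans (@card_bigcup_leq _ _ G
  (fun B => [set S : {set T} | (B \subset S) && (#|S| == n)]) _ _); last first.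
  by move=> B /cardG <-; exact: card_supersets_leq.
apply/subset_leq_card/fintype.subsetP => S; rewrite inE => cS.
have [B BG BS] := hit S (eqP cS).
by apply/bigcupP; exists B => //; rewrite inE BS.
Qed.

(** * Leaf sets as address predicates, and the sets that are not copies *)

Lemma card_leaf_of (T : tree) : #|{: leaf_of T}| = nleaves T.
Proof. by rewrite card_seq_sub ?uniq_leaves. Qed.

Lemma card_leaf_set (T : tree) (P : pred address) :
  #|[set x : leaf_of T | P (val x)]| = count P (leaves T).
Proof.
rewrite cardE -(size_map val) -size_filter; apply/perm_size/uniq_perm.
- by rewrite map_inj_uniq ?enum_uniq//; exact: val_inj.
- exact/filter_uniq/uniq_leaves.
move=> a; rewrite mem_filter; apply/mapP/andP.
  by move=> [x]; rewrite mem_enum inE => Px ->; rewrite Px; split=> //; exact: valP.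
by move=> [Pa al]; exists (SeqSub al); rewrite ?mem_enum ?inE.
Qed.

Definition in_set_pred (T : tree) (S : {set leaf_of T}) : pred address :=
  fun a => a \in [seq val x | x in S].

Lemma in_set_predE (T : tree) (S : {set leaf_of T}) (x : leaf_of T) :
  in_set_pred S (val x) = (x \in S).
Proof. by rewrite /in_set_pred fintype.mem_image//; exact: val_inj. Qed.

Lemma count_in_set_pred (T : tree) (S : {set leaf_of T}) :
  count (in_set_pred S) (leaves T) = #|S|.
Proof.
rewrite -card_leaf_set; congr #|pred_of_set _|; apply/setP => x.
by rewrite inE in_set_predE.
Qed.

Lemma inducedE (T : tree) (S : {set leaf_of T}) : Defs.induced S = trestrict (in_set_pred S) T.
Proof. exact: suppress_reroot. Qed.

Lemma induced_leaf_set (T : tree) (P : pred address) :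
  Defs.induced [set x : leaf_of T | P (val x)] = trestrict P T.
Proof.
rewrite inducedE; congr Defs.contract; apply: eq_in_prune => a al.
by rewrite (in_set_predE _ (SeqSub al)) inE.
Qed.

Definition noncopies (D T : tree) : {set {set leaf_of T}} :=
  [set S : {set leaf_of T} | (#|S| == nleaves D) && ~~ tree_iso (Defs.induced S) D].

Lemma copies_noncopies (D T : tree) :
  copies D T + #|noncopies D T| = 'C(nleaves T, nleaves D).
Proof.
rewrite -card_leaf_of -card_draws.
rewrite -[RHS](cardsID [set S | tree_iso (Defs.induced S) D]); congr (_ + _).
  by rewrite /copies; apply: eq_card => S; rewrite !inE.
by apply: eq_card => S; rewrite !inE andbC.
Qed.

Lemma noncopies_large (d : nat) (D T : tree) : 2 <= d -> 2 <= nleaves D ->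
  ~~ tree_iso D (caterpillar (nleaves D)) ->
  strictly_dary d T -> d ^ nleaves D <= nleaves T ->
  'C(nleaves T, nleaves D) <= #|noncopies D T| * 'C(d ^ nleaves D, nleaves D).
Proof.
move=> d2 D2 Dcat dT szT.
rewrite -card_leaf_of; apply: hitting_family_large.
- by rewrite card_leaf_of szT andbT ltnW// ltn_expl.
- by move=> S; rewrite inE => /andP[/eqP].
move=> S cS; move: D2 Dcat cS; case Dk: (nleaves D) => [//|k] _ Dcat cS.
(* With [nleaves D = k.+1], already [d ^ k] leaves suffice, and [S] has [d ^ k.+1]. *)
have [|Q [QS cQ isoQ]] := @exists_caterpillar d T (in_set_pred S) k d2 dT.
  by rewrite count_in_set_pred cS leq_exp2l.
exists [set x : leaf_of T | Q (val x)]; last first.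
  by apply/fintype.subsetP => x; rewrite inE => /QS; rewrite in_set_predE.
rewrite inE Dk card_leaf_set cQ eqxx induced_leaf_set.
apply: contra Dcat => QD; rewrite tree_iso_sym in QD.
exact: tree_iso_trans QD isoQ.
Qed.

(** Write n and k for the leaf counts of the large tree and of [D]. A non-copy contains two leaves
    of equal depth, so there are at most n d C(n-2, k-2) of them. Then [m <= n - 1] and n (n-1)
    C(n-2, k-2) = k (k-1) C(n, k) give the bound, a division-free form of O(1/m). *)
Lemma noncopies_dary_caterpillar (d m : nat) (D : tree) : 2 <= d -> 2 <= nleaves D ->
  tree_iso D (caterpillar (nleaves D)) ->
  m * #|noncopies D (dary_caterpillar d m)| <=
  d * nleaves D ^ 2 * 'C((d.-1 * m).+1, nleaves D).
Proof.
move=> d2 D2 Dcat; set T := dary_caterpillar d m.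
set n := (d.-1 * m).+1; have nT : #|{: leaf_of T}| = n.
  by rewrite card_leaf_of nleaves_dary_caterpillar.
pose Z (x : leaf_of T) := [set y : leaf_of T | (y != x) && (size (val y) == size (val x))].
have Zd x : #|Z x| <= d.
  apply: leq_trans (count_depth_dary_caterpillar m (size (val x)) (ltnW d2)).
  rewrite -card_leaf_set; apply/subset_leq_card/fintype.subsetP => y.
  by rewrite !inE => /andP[].
have sub : noncopies D T \subset \bigcup_(x in [set: leaf_of T]) \bigcup_(y in Z x)
    [set S : {set leaf_of T} | ([set x; y] \subset S) && (#|S| == nleaves D)].
  apply/fintype.subsetP => S; rewrite inE => /andP[cS]; apply: contraNT => nS.
  rewrite tree_iso_sym (tree_iso_trans Dcat)// tree_iso_sym inducedE.
  move: cS D2 Dcat; case Dk: (nleaves D) => [//|k] /eqP cS _ _.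
  apply: dary_caterpillar_restrict; rewrite ?count_in_set_pred// => a b al bl.
  rewrite (in_set_predE _ (SeqSub al)) (in_set_predE _ (SeqSub bl)) => aS bS sab.
  apply/eqP/negPn/negP => ab; move/negP: nS; apply.
  apply/bigcupP; exists (SeqSub al) => //; apply/bigcupP; exists (SeqSub bl).
    rewrite inE; apply/andP; split; last by rewrite /= sab.
    by apply: contraNN ab => /eqP[->].
  by rewrite inE cS Dk eqxx andbT finset.subUset !finset.sub1set aS.
have {sub} bound : #|noncopies D T| <= n * (d * 'C(n - 2, nleaves D - 2)).
  apply: (leq_trans (subset_leq_card sub)); rewrite -nT -finset.cardsT.
  apply: card_bigcup_leq => x _.
  apply: (@leq_trans (#|Z x| * 'C(#|{: leaf_of T}| - 2, nleaves D - 2))).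
    apply: card_bigcup_leq => y; rewrite inE => /andP[yx _].
    by have := card_supersets_leq [set x; y] (nleaves D); rewrite cards2 eq_sym yx.
  by rewrite finset.cardsT leq_mul2r Zd orbT.
have {}bound : m * #|noncopies D T| <= d * (n * (n.-1 * 'C(n - 2, nleaves D - 2))).
  apply: (@leq_trans (n.-1 * #|noncopies D T|)).
    by rewrite leq_mul2r /n/= leq_pmull ?orbT//; lia.
  by rewrite mulnCA (mulnCA d) (mulnCA n) leq_mul2l mulnCA (mulnCA d) bound orbT.
apply: (leq_trans bound); rewrite -mulnA leq_mul2l; apply/orP; right.
move: D2; case: (nleaves D) => [//|[//|k]] _; rewrite !subSS subn1 -[d.-1 * m]/n.-1.
rewrite (mul_bin_diag n.-1) (mulnCA n) (mul_bin_diag n) subn0 mulnA leq_mul2r.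
by apply/orP; right; lia.
Qed.

Import Order.TTheory GRing.Theory Num.Theory.
Import numFieldNormedType.Exports.

(** * Densities *)

Local Open Scope ring_scope.

Lemma densityE (R : realType) (D T : tree) : (nleaves D <= nleaves T)%N ->
  density R D T = 1 - #|noncopies D T|%:R / 'C(nleaves T, nleaves D)%:R.
Proof.
move=> DT; rewrite /density.
have C0 : ('C(nleaves T, nleaves D))%:R != 0 :> R by rewrite pnatr_eq0 -lt0n bin_gt0.
by apply: (mulIf C0); rewrite mulrBl !divfK// mul1r -copies_noncopies natrD addrK.
Qed.

Lemma density_le1 (R : realType) (D T : tree) : density R D T <= 1.
Proof.
have [DT|TD] := leqP (nleaves D) (nleaves T).
  by rewrite densityE// lerBlDr lerDl divr_ge0.
(* The binomial coefficient is 0 here, and so is its inverse by convention. *)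
by rewrite /density bin_small// invr0 mulr0.
Qed.

(** The limit superior is at most the supremum over the tail [N <= m], where [d >= 2] gives
    [(d.-1 * m).+1 > N]. *)
Lemma inducibility_le (R : realType) (d : nat) (D : tree) (c : R) (N : nat) :
  (2 <= d)%N ->
  (forall T, strictly_dary d T -> (N <= nleaves T)%N -> density R D T <= c) ->
  (inducibility R d D <= c%:E)%E.
Proof.
move=> d2 Dc; rewrite /inducibility /limn_esup limf_esupE.
apply: ge_ereal_inf; exists (ereal_sup
    [set max_density R d D (d.-1 * m).+1 | m in [set m | (N <= m)%N]]%classic).
  by exists [set m | (N <= m)%N]%classic => //; exists N.
apply: ge_ereal_sup => _ [m /= Nm <-]; apply: ge_ereal_sup => _ [T [dT nT] <-].
by rewrite lee_fin Dc// nT; nia.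
Qed.

Lemma caterpillar_inducibility (R : realType) (d : nat) (D : tree) :
  (2 <= d)%N -> (2 <= nleaves D)%N -> tree_iso D (caterpillar (nleaves D)) ->
  inducibility R d D = 1%E.
Proof.
move=> d2 D2 Dcat; set u := fun m : nat => max_density R d D (d.-1 * m).+1.
(* The factor 2 pays for replacing 1/m by [harmonic m], which is 1/(m+1), as [m.+1 <= 2 * m]. *)
pose c : R := (2 * (d * nleaves D ^ 2))%:R.
have u_lower m : (nleaves D <= m)%N -> 1 - c * harmonic m <= density R D (dary_caterpillar d m).
  move=> Dm; have nT := nleaves_dary_caterpillar d m.
  have DT : (nleaves D <= (d.-1 * m).+1)%N by nia.
  rewrite densityE nT// lerD2l lerN2 ler_pdivrMr ?ltr0n ?bin_gt0//.
  rewrite /harmonic mulrAC ler_pdivlMr ?ltr0n//= /c -!natrM ler_nat.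
  have := noncopies_dary_caterpillar m d2 D2 Dcat; set X := #|_| => bound.
  apply: (@leq_trans (2 * (m * X))); first by have := leq_trans D2 Dm; nia.
  lia.
(* The maximal densities converge to 1, so their limit superior is that limit. *)
suff /cvg_limn_einf_sup[] : (u @ \oo --> 1%E)%classic by [].
apply: (@squeeze_cvge _ _ _ _ (fun m => (1 - c * harmonic m)%:E) _ (fun=> 1%E)).
- near=> m; apply/andP; split.
    have Dm : (nleaves D <= m)%N by near: m; exact: nbhs_infty_ge.
    apply: le_trans (_ : (density R D (dary_caterpillar d m))%:E <= _)%E.
      by rewrite lee_fin u_lower.
    apply: ereal_sup_ubound; exists (dary_caterpillar d m) => //; split.
      exact/dary_caterpillar_strict/ltnW.
    exact: nleaves_dary_caterpillar.
  by apply: ge_ereal_sup => _ [T _ <-]; rewrite lee_fin density_le1.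
- apply: cvg_EFin; first exact: nearW.
  rewrite -[X in (_ --> X)%classic]subr0 -[X in 1 - X](mulr0 c).
  by apply: cvgB; [exact: cvg_cst|apply: cvgMr; exact: cvg_harmonic].
- exact: cvg_cst.
Unshelve. all: by end_near. Qed.

Theorem theorem10 (R : realType) (d : nat) (D : tree) :
  (2 <= d)%N -> dary d D -> (2 <= nleaves D)%N ->
  (inducibility R d D = 1%:E)%R <->
  tree_iso D (caterpillar (nleaves D)).
Proof.
move=> d2 _ D2; split; last exact: caterpillar_inducibility.
move=> D1; apply/negPn/negP => Dcat.
set N := (d ^ nleaves D)%N; have DN : (nleaves D <= N)%N by rewrite ltnW// ltn_expl.
have CN0 : 0 < ('C(N, nleaves D))%:R :> R by rewrite ltr0n bin_gt0.
(* By [noncopies_large], non-copies make up at least the fraction [1 / 'C(N, nleaves D)] once [T]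
   has [N] leaves. *)
suff : (inducibility R d D <= (1 - ('C(N, nleaves D))%:R^-1)%:E)%E.
  by rewrite D1 lee_fin lerBrDr gerDl invr_le0 leNgt CN0.
apply: (@inducibility_le _ _ _ _ N) => // T dT NT; have DT := leq_trans DN NT.
rewrite densityE// lerD2l lerN2 ler_pdivlMr ?ltr0n ?bin_gt0//.
by rewrite mulrC ler_pdivrMr// -natrM ler_nat noncopies_large.
Qed.
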